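(* Let $\theta=[b_0;b_1,b_2,\ldots]$ be an irrational number whose simple continued fraction has the form $$\theta=[a_0;c_1,\ldots,c_{n_1},a_1,c_{n_1+1},\ldots,c_{n_1+n_2},a_2,\ldots],$$ where $n_i\ge 0$ for all $i$, $\lim_{i\to\infty}a_i=\infty$, and either $\{c_i\}$ is a finite sequence or $\limsup_{i\to\infty}c_i=1$. Let $n\ge 2$ be an integer such that the partial quotient sequence $(b_i)_{i\ge 0}$ of $\theta$ is completely periodic modulo $n$. If each $n_i\in\{0,2\}$, then $$n^2L(\theta,\phi)\in\{0,1/2\}\quad\text{for both } \phi=1/n \text{ and } \phi=-\theta/n.$$ In particular, for every integer $k\ge 2$ and every integer $n\ge 2$, $$n^2L(e^{2/k},\phi)\in\{0,1/2\}\quad\text{for both } \phi=1/n\text{ and }\phi=-e^{2/k}/n.$$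
   Context: For real numbers $\theta,\phi$ with $\phi\notin\mathbb{Z}\theta+\mathbb{Z}$, the inhomogeneous approximation constant is $L(\theta,\phi)=\liminf_{|q|\to\infty}\{|q|\,\|q\theta-\phi\| : q\in\mathbb{Z}\}$, where $\|x\|$ is the distance from $x$ to the nearest integer. In the displayed continued fraction, $n_i$ is the number of terms $c$ lying between $a_{i-1}$ and $a_i$ ($i\ge1$). A sequence $(b_i)_{i\ge0}$ of integers is completely periodic modulo $n$ if there is $T\ge1$ with $b_{i+T}\equiv b_i\pmod n$ for all $i\ge 0$. *)

(* Defs.v *)
From HB Require Import structures.
From mathcomp Require Import all_boot all_order all_algebra.
From mathcomp Require Import all_classical all_reals all_analysis.
Set Implicit Arguments.
Unset Strict Implicit.
Unset Printing Implicit Defensive.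
Import Order.TTheory GRing.Theory Num.Theory.
Import numFieldNormedType.Exports.
Local Open Scope classical_set_scope.
Local Open Scope ring_scope.

Definition dist_int (R : realType) (x : R) : R :=
  Num.min (x - (Num.floor x)%:~R) ((Num.ceil x)%:~R - x).

(* The liminf as |q| --> oo (q of both signs), as the supremum over N of the
   infimum over |q| >= N.  Total in theta and phi, although the constant is only
   considered for phi outside Z theta + Z. *)
Definition inhom_const (R : realType) (theta phi : R) : \bar R :=
  ereal_sup [set ereal_inf
    [set (`|q|%:~R * dist_int (q%:~R * theta - phi))%:E
      | q in [set q : int | (N <= `|q|)%N]]
    | N in [set: nat]].

(* complete_quotient x i is the x_i of x_0 = x, x_(i+1) = 1/(x_i - floor x_i),
   and partial_quotient x i = floor x_i.  For irrational x no division by zero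
   occurs, and x = [b_0; b_1, b_2, ...] with b_i = partial_quotient x i. *)
Definition complete_quotient (R : realType) (x : R) (i : nat) : R :=
  iter i (fun y : R => (y - (Num.floor y)%:~R)^-1) x.

Definition partial_quotient (R : realType) (x : R) (i : nat) : int :=
  Num.floor (complete_quotient x i).

(* n_1 + ... + n_i *)
Definition cum_len (len : nat -> nat) (i : nat) : nat :=
  (\sum_(1 <= j < i.+1) len j)%N.

(* b = a_0, c_1, ..., c_(n_1), a_1, c_(n_1+1), ..., c_(n_1+n_2), a_2, ...
   with n_i = len i.  The values len 0 and c 0 are unused; if only finitely
   many c occur in b, the values of c beyond the last one are unused too. *)
Definition interleaves (b a c : nat -> int) (len : nat -> nat) : Prop :=
  forall i : nat,
    b (i + cum_len len i)%N = a i /\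
    forall m : nat, (1 <= m <= len i.+1)%N ->
      b (i + cum_len len i + m)%N = c (cum_len len i + m)%N.

Definition finitely_many_terms (len : nat -> nat) : Prop :=
  exists M : nat, forall i : nat, (cum_len len i <= M)%N.

Definition completely_periodic_mod (n : nat) (b : nat -> int) : Prop :=
  exists T : nat, (1 <= T)%N /\
    forall i : nat, (b (i + T)%N = b i %[mod n%:Z])%Z.

(* Main.v *)
Require Import Defs.
From HB Require Import structures.
From mathcomp Require Import all_boot all_order all_algebra all_fingroup.
From mathcomp Require Import all_classical all_reals all_analysis.
From mathcomp Require Import zify ring lra.
Set Implicit Arguments.
Unset Strict Implicit.
Unset Printing Implicit Defensive.
Import Order.TTheory GRing.Theory Num.Theory.
Import numFieldNormedType.Exports.
Local Open Scope classical_set_scope.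
Local Open Scope ring_scope.

(** Multiplying by n^2 turns |q| ||q theta - phi|| into |Q| |Q theta - P|, where
(P, Q) runs over the integer pairs congruent to (1, 0), resp. (0, 1), modulo n.
By Legendre's theorem, values below 1/2 only come from multiples of convergents.
The shape of the continued fraction forces the value at a convergent to tend to
0 (before a large partial quotient) or to 1/2 (before a 1 in a pair of 1's
between large partial quotients). If multiples of convergents of the first kind
fall in the class infinitely often, reducing the multiplier modulo n shows that
the liminf is 0; otherwise it is at least 1/2. It is never more than 1/2: the
matrices of consecutive convergents modulo n are, along multiples of the period,
the powers of an invertible matrix over the finite ring Z/n, so infinitely many
of them are the identity, and convergents themselves lie in both classes
infinitely often.

For e^(2/k) = (coth (1/k) + 1) / (coth (1/k) - 1), the expansion follows from
coth (1/k) = [k; 3k, 5k, ...]. *)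

(** * Convergents modulo n *)

Fixpoint cf_pair (b : nat -> int) (u v : int) (k : nat) : int * int :=
  if k is k'.+1 then
    let w := cf_pair b u v k' in (w.2, b k' * w.2 + w.1)
  else (u, v).

(* Numerators are cf_seq b 0 1 and denominators cf_seq b 1 0; the index is
   shifted by 2 with respect to the usual p_k, q_k, so that both sequences start
   at p_(-2), q_(-2). *)
Definition cf_seq (b : nat -> int) (u v : int) (k : nat) : int :=
  (cf_pair b u v k).1.

Lemma cf_seqS b u v k :
  cf_seq b u v k.+2 = b k * cf_seq b u v k.+1 + cf_seq b u v k.
Proof. by []. Qed.

Lemma cf_seq0 b u v : cf_seq b u v 0 = u. Proof. by []. Qed.

Lemma cf_seq1 b u v : cf_seq b u v 1 = v. Proof. by []. Qed.

Lemma intr_cf_seqS (F : pzRingType) b u v k :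
  (cf_seq b u v k.+2)%:~R
    = (b k)%:~R * (cf_seq b u v k.+1)%:~R + (cf_seq b u v k)%:~R :> F.
Proof. by rewrite cf_seqS intrD intrM. Qed.

Lemma finite_order_unit (F : finUnitRingType) (u : F) :
  u \is a GRing.unit -> exists2 m, (0 < m)%N & u ^+ m = 1.
Proof.
move=> Uu; exists #[FinRing.Unit Uu]%g; first exact: order_gt0.
by rewrite -(FinRing.val_unitX _ (FinRing.Unit Uu)) expg_order.
Qed.

Lemma intr_Zp_eq0 (n : nat) (z : int) :
  (1 < n)%N -> (z%:~R == 0 :> 'Z_n) = (n%:Z %| z)%Z.
Proof.
move=> n1; have n0 : n%:Z != 0 by lia.
have nR : (n%:Z%:~R : 'Z_n) = 0 by rewrite -pmulrn pchar_Zp.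
rewrite [in LHS](divz_eq z n) intrD intrM nR mulr0 add0r.
have := modz_ge0 z n0; have := ltz_mod z n0.
rewrite (sameP dvdz_mod0P eqP).
case: (z %% n)%Z => // m lt_mn _; rewrite -pmulrn.
apply/eqP/eqP => [|[->] //]; move=> /(congr1 val) /=; rewrite val_Zp_nat //.
by rewrite modn_small => [->//|]; lia.
Qed.

(** The matrix with rows (z, 1) and (1, 0), of determinant -1; multiplying by it on the right
    performs one step of the recurrence for convergents. *)
Definition cf_step (F : pzRingType) (z : int) : 'M[F]_2 :=
  \matrix_(i, j) if (i == 0) && (j == 0) then z%:~R else (i != j)%:R.

Fixpoint cf_mx (F : pzRingType) (b : nat -> int) (k : nat) : 'M[F]_2 :=
  if k is k'.+1 then cf_mx F b k' *m cf_step F (b k') else 1%:M.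

Lemma cf_mxE (F : pzRingType) (b : nat -> int) (k : nat) :
  [/\ cf_mx F b k 0 0 = (cf_seq b 0 1 k.+1)%:~R,
      cf_mx F b k 1 0 = (cf_seq b 1 0 k.+1)%:~R,
      cf_mx F b k 0 1 = (cf_seq b 0 1 k)%:~R &
      cf_mx F b k 1 1 = (cf_seq b 1 0 k)%:~R].
Proof.
elim: k => [|k [h00 h10 h01 h11]].
  by rewrite !cf_seq0 !cf_seq1 !mxE.
have ord2 (f : 'I_2 -> F) : \sum_j f j = f 0 + f 1.
  rewrite !big_ord_recl big_ord0 addr0; congr (_ + f _); exact/val_inj.
rewrite !intr_cf_seqS.
split; rewrite /= mxE ord2 ?h00 ?h10 ?h01 ?h11 !mxE /=.
- by rewrite mulr1 -!intrM mulrC.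
- by rewrite mulr1 -!intrM mulrC.
- by rewrite mulr0 addr0 mulr1.
- by rewrite mulr0 addr0 mulr1.
Qed.

Lemma cf_mxD (F : pzRingType) (b : nat -> int) (k l : nat) :
  cf_mx F b (k + l) = cf_mx F b k *m cf_mx F (fun i => b (k + i)%N) l.
Proof.
by elim: l => [|l IH]; rewrite ?addn0 /= ?mulmx1// addnS /= IH mulmxA.
Qed.

Lemma eq_cf_mx (F : pzRingType) (b b' : nat -> int) (k : nat) :
  (forall i, (b i)%:~R = (b' i)%:~R :> F) -> cf_mx F b k = cf_mx F b' k.
Proof.
move=> bb'; elim: k => //= k ->; congr (_ *m _).
by apply/matrixP => i j; rewrite !mxE bb'.
Qed.

Lemma cf_mx_unit (F : comUnitRingType) (b : nat -> int) (k : nat) :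
  cf_mx F b k \in unitmx.
Proof.
elim: k => [|k IH] /=; first exact: unitmx1.
rewrite unitmx_mul IH /= unitmxE (expand_det_row _ 0) /cofactor.
rewrite !big_ord_recl big_ord0 !det_mx11 !mxE /=.
by rewrite !mulr0 add0r addr0 mul1r mulr1 expr1 unitrN1.
Qed.

(** Cut the product into blocks of T factors: over ['Z_n] the factors depend on [b] modulo n only,
    so all blocks are equal. *)
Lemma cf_mx_periodic (n T : nat) (b : nat -> int) :
  (1 < n)%N -> (forall i, (b (i + T)%N = b i %[mod n%:Z])%Z) ->
  forall j, cf_mx 'Z_n b (j * T) = cf_mx 'Z_n b T ^+ j.
Proof.
move=> n1 bT; elim => [|j IH] //.
rewrite mulSn cf_mxD exprS; congr (_ * _); rewrite -IH.
apply: eq_cf_mx => i; apply/eqP; rewrite -subr_eq0 -intrB intr_Zp_eq0//.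
by rewrite -eqz_mod_dvd addnC; apply/eqP/bT.
Qed.

Lemma convergents_return (n : nat) (b : nat -> int) :
  (1 < n)%N -> completely_periodic_mod n b ->
  forall K, exists2 k, (K <= k)%N &
    ([/\ (n %| cf_seq b 0 1 k.+1 - 1)%Z, (n %| cf_seq b 1 0 k.+1)%Z,
         (n %| cf_seq b 0 1 k)%Z & (n %| cf_seq b 1 0 k - 1)%Z]).
Proof.
move=> n1 [T [T0 bT]] K.
have [m m0 Am] := finite_order_unit (cf_mx_unit 'Z_n b T).
(* At a multiple of m periods the matrix is the identity. Its columns are the convergents k+1 and k,
   which lie in the classes (1, 0) and (0, 1). *)
exists (K * m * T)%N; first by rewrite -mulnA leq_pmulr // muln_gt0 m0.
have := cf_mxE 'Z_n b (K * m * T); rewrite cf_mx_periodic// mulnC exprM Am.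
rewrite expr1n !mxE /= => -[h00 h10 h01 h11].
by rewrite -!intr_Zp_eq0 // !intrB -h00 -h10 -h01 -h11 !subrr eqxx.
Qed.

(** * Approximation by convergents *)

(* Allowing b 1 = 0 admits the expansion [1; 0, 1, 1, 2, 1, 1, 4, ...] of e,
   which, unlike the regular one, is periodic modulo every n. *)
Definition cf_expansion (R : realType) (theta : R) (b : nat -> int)
    (x : nat -> R) : Prop :=
  [/\ x 0%N = theta, forall i, x i = (b i)%:~R + (x i.+1)^-1,
      forall i, 0 < x i.+1, 0 <= b 1%N & forall i, 1 <= b i.+2].

Definition cf_err (R : realType) (theta : R) (b : nat -> int) (k : nat) : R :=
  (cf_seq b 1 0 k)%:~R * theta - (cf_seq b 0 1 k)%:~R.

Definition cf_val (R : realType) (theta : R) (b : nat -> int) (k : nat) : R :=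
  (cf_seq b 1 0 k)%:~R * `|cf_err theta b k|.

Lemma cf_det (b : nat -> int) (k : nat) :
  cf_seq b 1 0 k * cf_seq b 0 1 k.+1 - cf_seq b 1 0 k.+1 * cf_seq b 0 1 k
    = (-1) ^+ k.
Proof.
elim: k => [|k IH]; first by rewrite !cf_seq0 !cf_seq1 !mulr1 mulr0 subr0.
rewrite !cf_seqS exprS -IH; ring.
Qed.

Lemma cf_errS (R : realType) (theta : R) (b : nat -> int) (k : nat) :
  cf_err theta b k.+2 = (b k)%:~R * cf_err theta b k.+1 + cf_err theta b k.
Proof. rewrite /cf_err !intr_cf_seqS; ring. Qed.

(** Since b_1 may be 0, so may Q_3 = b_1; positivity is guaranteed throughout only from index 4 on,
    hence the indices [k.+4] below. *)
Lemma cf_den_gt0 (b : nat -> int) (k : nat) :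
  0 <= b 1%N -> (forall i, 1 <= b i.+2) ->
  0 <= cf_seq b 1 0 k.+3 /\ 1 <= cf_seq b 1 0 k.+4.
Proof.
move=> b1 b2.
have Q2 : cf_seq b 1 0 2 = 1 by rewrite cf_seqS cf_seq0 cf_seq1 mulr0 add0r.
have Q3 : cf_seq b 1 0 3 = b 1%N.
  by rewrite cf_seqS Q2 cf_seq1 mulr1 addr0.
elim: k => [|k [h3 h4]].
  by have := b2 0%N; rewrite [cf_seq _ _ _ 4]cf_seqS Q2 Q3; split; nia.
by have := b2 k.+1; rewrite [cf_seq _ _ _ k.+4.+1]cf_seqS; split; nia.
Qed.

Lemma cf_den_ge0 (b : nat -> int) (k : nat) :
  0 <= b 1%N -> (forall i, 1 <= b i.+2) -> 0 <= cf_seq b 1 0 k.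
Proof.
move=> b1 b2; case: k => [|[|[|k]]]; rewrite ?cf_seqS ?cf_seq0 ?cf_seq1 ?mulr0 //.
by rewrite -cf_seqS; case: (cf_den_gt0 k b1 b2).
Qed.

Lemma cf_den_leS (b : nat -> int) (k : nat) :
  0 <= b 1%N -> (forall i, 1 <= b i.+2) ->
  cf_seq b 1 0 k.+4 <= cf_seq b 1 0 k.+4.+1.
Proof.
move=> b1 b2; have [h3 h4] := cf_den_gt0 k b1 b2.
by have := b2 k.+1; rewrite [cf_seq _ _ _ k.+4.+1]cf_seqS; nia.
Qed.

Lemma cf_den_growth (b : nat -> int) (k : nat) :
  0 <= b 1%N -> (forall i, 1 <= b i.+2) -> k.+1%:Z <= cf_seq b 1 0 k.+4.+1.
Proof.
move=> b1 b2; elim: k => [|k IH]; first by case: (cf_den_gt0 1 b1 b2).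
have [_ h] := cf_den_gt0 k b1 b2.
by have := b2 k.+2; rewrite [cf_seq _ _ _ k.+4.+2]cf_seqS; nia.
Qed.

Section Expansion.
Variables (R : realType) (theta : R) (b : nat -> int) (x : nat -> R).
Hypothesis Ex : cf_expansion theta b x.
Local Notation P := (cf_seq b 0 1).
Local Notation Q := (cf_seq b 1 0).
Local Notation D := (cf_err theta b).

Let b1 : 0 <= b 1%N. Proof. by case: Ex. Qed.
Let b2 i : 1 <= b i.+2. Proof. by case: Ex. Qed.

(** By induction, D_(k+2) = (b_k - x_k) D_(k+1) = - D_(k+1) / x_(k+1); the start is D_0 = theta, D_1
    = -1. *)
Lemma cf_err_quotient k : D k = - x k * D k.+1.
Proof.
have [x0 xS xp _ _] := Ex; elim: k => [|k IH].
  by rewrite /cf_err !cf_seq0 !cf_seq1 x0; ring.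
have x1 : x k.+1 != 0 by rewrite gt_eqF.
by rewrite cf_errS IH (xS k); field.
Qed.

(** The determinant of two consecutive convergents is Q_(k+2) D_(k+1) - Q_(k+1) D_(k+2) up to sign;
    eliminate D_(k+1) by [cf_err_quotient]. *)
Lemma cf_err_norm k : `|D k.+2| * ((Q k.+1)%:~R + x k.+1 * (Q k.+2)%:~R) = 1.
Proof.
have [_ _ xp _ _] := Ex.
have det :
  `|(Q k.+1)%:~R * (P k.+2)%:~R - (Q k.+2)%:~R * (P k.+1)%:~R| = 1 :> R.
  by rewrite -!intrM -intrB cf_det rmorphXn /= rmorphN normrX normrN1 expr1n.
apply: (etrans _ det).
have w0 : 0 <= (Q k.+1)%:~R + x k.+1 * (Q k.+2)%:~R.
  by rewrite addr_ge0 ?mulr_ge0 ?ler0z ?cf_den_ge0 // ltW.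
rewrite -(ger0_norm w0) -normrM.
have -> : (Q k.+1)%:~R * (P k.+2)%:~R - (Q k.+2)%:~R * (P k.+1)%:~R
  = - ((Q k.+1)%:~R * D k.+2 - (Q k.+2)%:~R * D k.+1) by rewrite /cf_err; ring.
by rewrite normrN (cf_err_quotient k.+1); congr `|_|; ring.
Qed.

(** The expansion read backwards: Q_k / Q_(k+1) = [0; b_(k-1), b_(k-2), ...], by [cf_backS]. *)
Definition cf_back k : R := (Q k)%:~R / (Q k.+1)%:~R.

Lemma cf_back_ge0 k : 0 <= cf_back k.
Proof. by rewrite divr_ge0 // ler0z cf_den_ge0. Qed.

Lemma cf_backS k : cf_back k.+4 = ((b k.+3)%:~R + cf_back k.+3)^-1.
Proof.
have [h3 h4] := cf_den_gt0 k b1 b2; have [_ h5] := cf_den_gt0 k.+1 b1 b2.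
rewrite /cf_back (intr_cf_seqS _ _ _ _ k.+3).
have q4 : (Q k.+4)%:~R != 0 :> R by rewrite intr_eq0; lia.
have q5 : (b k.+3)%:~R * (Q k.+4)%:~R + (Q k.+3)%:~R != 0 :> R.
  by rewrite -intr_cf_seqS intr_eq0; lia.
by field; rewrite q4 q5.
Qed.

(** [cf_err_norm] divided by Q_(k+4). The value at a convergent is thus governed by the next partial
    quotient, its successors (through x) and its predecessors (through [cf_back]). *)
Lemma cf_valE k : cf_val theta b k.+4 = (x k.+3 + cf_back k.+3)^-1.
Proof.
have [h3 h4] := cf_den_gt0 k b1 b2; have [_ _ xp _ _] := Ex.
have q4 : 0 < (Q k.+4)%:~R :> R by rewrite ltr0z; lia.
have q3 : 0 <= (Q k.+3)%:~R :> R by rewrite ler0z.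
have w0 : 0 < (Q k.+3)%:~R + x k.+3 * (Q k.+4)%:~R.
  by rewrite ltr_wpDl // mulr_gt0.
have /(canRL (mulfK (lt0r_neq0 w0))) := cf_err_norm k.+2.
rewrite mul1r /cf_val /cf_back => ->; field.
by rewrite !gt_eqF //= addrC.
Qed.

Lemma cf_quotient_ge k : (b k.+1)%:~R <= x k.+1.
Proof. by have [_ xS xp _ _] := Ex; rewrite (xS k.+1) lerDl invr_ge0 ltW. Qed.

Lemma cf_back_le k (A : R) : 0 < A -> A <= (b k.+3)%:~R -> cf_back k.+4 <= A^-1.
Proof.
move=> A0 Ab; have h := cf_back_ge0 k.+3.
rewrite cf_backS lef_pV2 ?posrE //; first lra.
lra.
Qed.

Lemma cf_val_large k (A : R) : 0 < A -> A <= (b k.+3)%:~R ->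
  cf_val theta b k.+4 <= A^-1.
Proof.
move=> A0 Ab; have h := cf_back_ge0 k.+3; have := cf_quotient_ge k.+2.
move=> h1; rewrite cf_valE lef_pV2 ?posrE //; lra.
Qed.

Let inv_near1 (A t : R) :
  1 <= A -> 0 <= t <= A^-1 -> 1 - A^-1 <= (1 + t)^-1 <= 1.
Proof.
move=> A1 /andP[t0 tA]; have t1 : 0 < 1 + t by lra.
rewrite -[(1 + t)^-1]mul1r ler_pdivlMr // ler_pdivrMr //.
have : 0 <= A^-1 <= 1 by rewrite invr_ge0 invf_le1; lra.
by move=> /andP[? ?]; apply/andP; split; nra.
Qed.

Let quotient_near1 (A : R) k : 1 <= A -> b k = 1 -> A <= (b k.+1)%:~R ->
  1 <= x k <= 1 + A^-1.
Proof.
move=> A1 bk Ab; have [_ xS xp _ _] := Ex.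
rewrite (xS k) bk lerDl invr_ge0 (ltW (xp _)) /= lerD2l.
by rewrite lef_pV2 ?posrE //; have := cf_quotient_ge k; lra.
Qed.

(** Before the first 1, x = 1 + 1/x' with x' close to 1, so x is close to 2, while the backward
    fraction is at most 1/A. *)
Lemma cf_val_first1 k (A : R) : 1 <= A -> A <= (b k.+3)%:~R ->
  b k.+4 = 1 -> b k.+4.+1 = 1 -> A <= (b k.+4.+2)%:~R ->
  2 - A^-1 <= (cf_val theta b k.+4.+1)^-1 <= 2 + A^-1.
Proof.
move=> A1 A3 b4 b5 A6; have [_ xS xp _ _] := Ex; have A0 : 0 < A by lra.
have y0 := cf_back_ge0 k.+4; have yA := cf_back_le A0 A3.
have /andP[x1 xA] := quotient_near1 A1 b5 A6.
have : 0 <= x k.+4.+1 - 1 <= A^-1 by lra.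
move=> /(inv_near1 A1); rewrite addrCA subrr addr0 => /andP[i1 i2].
by rewrite cf_valE invrK (xS k.+4) b4; lra.
Qed.

(** Before the second 1, x is close to 1, and so is the backward fraction 1/(1 + y), where y is at
    most 1/A. *)
Lemma cf_val_second1 k (A : R) : 1 <= A -> A <= (b k.+3)%:~R ->
  b k.+4 = 1 -> b k.+4.+1 = 1 -> A <= (b k.+4.+2)%:~R ->
  2 - A^-1 <= (cf_val theta b k.+4.+2)^-1 <= 2 + A^-1.
Proof.
move=> A1 A3 b4 b5 A6; have A0 : 0 < A by lra.
have y0 := cf_back_ge0 k.+4; have yA := cf_back_le A0 A3.
have /andP[x1 xA] := quotient_near1 A1 b5 A6.
have : 0 <= cf_back k.+4 <= A^-1 by lra.
move=> /(inv_near1 A1) /andP[i1 i2].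
by rewrite cf_valE invrK cf_backS b4; lra.
Qed.

Lemma cf_bracket k (q : int) : Q k.+4 <= q ->
  exists2 l, (k.+4 <= l)%N & Q l <= q < Q l.+1.
Proof.
move=> kq; have ex : exists l, (k.+4 <= l)%N && (q < Q l.+1).
  exists (`|q| + k.+4)%N; rewrite leq_addl /=.
  by have := cf_den_growth (`|q| + k) b1 b2; rewrite !addnS; lia.
case: (ex_minnP ex) => l /andP[kl ql] lmin; exists l => //; rewrite ql andbT.
move: kl; rewrite leq_eqVlt => /orP[/eqP <- //|kl].
rewrite leNgt; apply/negP => ql1; have := lmin l.-1.
by rewrite prednK; [rewrite ql1 andbT -ltnS prednK; lia | lia].
Qed.

(* If (p, q) is not a multiple of the convergent l whose denominator is the
   largest one below q, its coordinates on the convergents l and l+1 are nonzero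
   of opposite signs, so (p, q) approximates theta no better than l does, and
   the determinant of (p, q) and l, a nonzero integer, would be smaller than 1. *)
Lemma legendre k (p q : int) : Q k.+4 <= q ->
  q%:~R * `|q%:~R * theta - p%:~R| < 1 / 2 :> R ->
  exists l (m : int), [/\ (k.+4 <= l)%N, p = m * P l & q = m * Q l].
Proof.
move=> kq; have [l kl /andP[lq ql]] := cf_bracket kq => small.
have e2 : ((-1) ^+ l * (-1) ^+ l : int) = 1.
  by rewrite -expr2 sqrr_sign.
have det := cf_det b l.
set e : int := (-1) ^+ l in e2 det.
(* Cramer's rule: s and t are the coordinates of (p, q) on the convergents l and l+1, whose
   determinant is e. *)
pose t := e * (Q l * p - P l * q); pose s := e * (q * P l.+1 - p * Q l.+1).
have pE : p = s * P l + t * P l.+1.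
  apply: (@etrans _ _ (e * (Q l * P l.+1 - Q l.+1 * P l) * p)).
    by rewrite det e2 mul1r.
  by rewrite /s /t; ring.
have qE : q = s * Q l + t * Q l.+1.
  apply: (@etrans _ _ (e * (Q l * P l.+1 - Q l.+1 * P l) * q)).
    by rewrite det e2 mul1r.
  by rewrite /s /t; ring.
exists l, s; case: (eqVneq t 0) => [t0|t0].
  by rewrite kl {1}pE {1}qE t0 !mul0r !addr0.
have ne0 : Q l * p - P l * q != 0.
  by apply: contraNneq t0; rewrite /t => ->; rewrite mulr0.
clearbody s t; exfalso.
have [l' lE] : exists l', l = l'.+4 by exists (l - 4)%N; lia.
have [_ Ql] := cf_den_gt0 l' b1 b2; rewrite -lE in Ql.
have Qll := cf_den_leS l' b1 b2; rewrite -lE in Qll.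
have [_ _ xp _ _] := Ex.
have xl : 0 < (x l)^-1 by rewrite invr_gt0 lE.
have dE : q%:~R * theta - p%:~R = D l * (s%:~R - t%:~R * (x l)^-1).
  have DE : D l.+1 = - D l * (x l)^-1.
    rewrite (cf_err_quotient l) !mulNr opprK mulrAC mulfV ?mul1r //.
    by rewrite -invr_eq0 gt_eqF.
  rewrite pE qE !intrD !intrM; rewrite /cf_err in DE *.
  transitivity (s%:~R * ((Q l)%:~R * theta - (P l)%:~R) +
                t%:~R * ((Q l.+1)%:~R * theta - (P l.+1)%:~R)); first ring.
  by rewrite DE; ring.
have far : `|D l| <= `|q%:~R * theta - p%:~R|.
  rewrite dE normrM ler_peMr //.
  (* Since Q_l <= q < Q_(l+1), the signs of s and t are opposite, so |s - t / x_l| >= |s| >= 1. *)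
  have [tp|tn] : 1 <= t \/ t <= -1 by lia.
    have : s <= -1 by nia.
    rewrite -(ler_int R) -(ler_int R) in tp *; rewrite -normrN => sn.
    apply: le_trans (ler_norm _); nra.
  have : 1 <= s by nia.
  rewrite -(ler_int R) -(ler_int R) in tn *; move=> sn.
  apply: le_trans (ler_norm _); nra.
(* The contradiction is 1 <= Q_l |q theta - p| + q |D_l| <= 2 q |q theta - p| < 1. *)
have : 1 <= `|(Q l)%:~R * (q%:~R * theta - p%:~R) - q%:~R * D l| :> R.
  rewrite [X in `|X|](_ : _ = ((- (Q l * p - P l * q))%:~R : R)).
    by rewrite -intr_norm ler1z; lia.
  by rewrite /cf_err rmorphN /= !intrD rmorphN /= !intrM; ring.
move=> /le_trans /(_ (ler_normB _ _)); rewrite !normrM.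
have q0 : 1 <= q by lia.
rewrite -(ler_int R) in q0; rewrite -(ler_int R) in lq.
rewrite -(ler_int R) in Ql.
rewrite (@ger0_norm _ (Q l)%:~R) ?(@ger0_norm _ q%:~R); [|lra|lra].
have d0 := normr_ge0 (q%:~R * theta - p%:~R).
have := ler_wpM2r d0 lq; have := ler_wpM2l (_ : 0 <= q%:~R) far; lra.
Qed.

End Expansion.
(** * The inhomogeneous constant *)

Lemma dist_int_le (R : realType) (y : R) (p : int) : dist_int y <= `|y - p%:~R|.
Proof.
have hf := floor_le y; have hc := ceil_ge y.
rewrite /dist_int ge_min; have [py|yp] := leP p%:~R y.
  apply/orP; left; rewrite ger0_norm; last lra.
  by rewrite lerB // ler_int floor_ge_int.
apply/orP; right; rewrite ltr0_norm; last lra.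
by rewrite opprB lerB // ler_int ceil_le_int ltW.
Qed.

Lemma dist_int_attained (R : realType) (y : R) :
  exists p : int, dist_int y = `|y - p%:~R|.
Proof.
have hf := floor_le y; have hc := ceil_ge y; rewrite /dist_int.
case: leP => _; [exists (Num.floor y)|exists (Num.ceil y)].
  by rewrite ger0_norm //; lra.
by rewrite distrC ger0_norm //; lra.
Qed.

Lemma inhom_const_eq (R : realType) (theta phi s c : R) : 0 < s ->
  (forall e : R, 0 < e -> forall N : nat, exists2 q : int, (N <= `|q|)%N &
     s * (`|q|%:~R * dist_int (q%:~R * theta - phi)) <= c + e) ->
  (forall e : R, 0 < e -> exists N : nat, forall q : int, (N <= `|q|)%N ->
     c - e <= s * (`|q|%:~R * dist_int (q%:~R * theta - phi))) ->
  (s%:E * inhom_const theta phi)%E = c%:E.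
Proof.
move=> s0 upper lower.
suff -> : inhom_const theta phi = (c / s)%:E.
  by rewrite -EFinM mulrC divfK // gt_eqF.
apply/le_anti/andP; split.
  apply: ge_ereal_sup => _ [N _ <-]; apply/lee_addgt0Pr => e e0.
  have [q Nq le_q] := upper _ (mulr_gt0 s0 e0) N.
  apply: (le_trans (ereal_inf_lbound _)); first by exists q.
  rewrite -EFinD lee_fin -(ler_pM2l s0) (le_trans le_q) // mulrDr.
  by rewrite [s * (c / s)]mulrC divfK // gt_eqF.
apply/lee_subgt0Pr => e e0.
have [N le_N] := lower _ (mulr_gt0 s0 e0).
apply: (le_trans _ (ereal_sup_ubound _)); last by exists N.
apply: le_ereal_inf_tmp => _ [q Nq <-].
rewrite -EFinB lee_fin -(ler_pM2l s0) (le_trans _ (le_N q Nq)) // mulrBr.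
by rewrite [s * (c / s)]mulrC divfK // gt_eqF.
Qed.

(** A local form of the shape of the expansion, shared by the regular expansions and those of
    e^(2/k): the entry at [k.+2] is large, or the first, or the second 1 of a pair between large
    entries. Starting at [k] leaves room for the two preceding entries. *)
Definition large_or_paired_ones (b : nat -> int) : Prop :=
  forall A : nat, exists K : nat, forall k : nat, (K <= k)%N ->
    [\/ A%:Z <= b k.+2,
        [/\ A%:Z <= b k.+1, b k.+2 = 1, b k.+3 = 1 & A%:Z <= b k.+4] |
        [/\ A%:Z <= b k, b k.+1 = 1, b k.+2 = 1 & A%:Z <= b k.+3]].

(** * Limiting values along the convergents *)

Section Asymptotics.
Variables (R : realType) (theta : R) (b : nat -> int) (x : nat -> R).
Hypothesis Ex : cf_expansion theta b x.
Hypothesis shape : large_or_paired_ones b.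
Local Notation P := (cf_seq b 0 1).
Local Notation Q := (cf_seq b 1 0).
Local Notation D := (cf_err theta b).
Local Notation val := (cf_val theta b).

Let b1 : 0 <= b 1%N. Proof. by case: Ex. Qed.
Let b2 i : 1 <= b i.+2. Proof. by case: Ex. Qed.

Lemma cf_val_limits (e : R) : 0 < e -> exists K : nat, forall k, (K <= k)%N ->
  val k <= 1 / 2 + e /\ (val k <= e \/ 1 / 2 - e <= val k).
Proof.
(* The cap at 1 keeps 2 - d positive and gives 1 / (2 - d) <= 1/2 + d in [near_half]. *)
move=> e0; pose d := Num.min e 1.
have d0 : 0 < d by rewrite lt_min e0 ltr01.
have de : d <= e by rewrite ge_min lexx.
have d1 : d <= 1 by rewrite ge_min lexx orbT.
have [A dA] : exists A : nat, d^-1 <= A%:R.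
  by exists (Num.truncn d^-1).+1; rewrite ltW // truncnS_gt.
have A1 : 1 <= A%:R :> R by rewrite (le_trans _ dA) // invf_ge1.
have Ad : (A%:R : R)^-1 <= d by rewrite invf_ple ?posrE //; lra.
have [K bK] := shape A; exists (K + 6)%N => k Kk.
have [l kl] : exists l, k = l.+4.+2 by exists (k - 6)%N; lia.
rewrite kl {k kl} in Kk *.
have near_half v : 2 - A%:R^-1 <= v^-1 <= 2 + A%:R^-1 ->
    v <= 1 / 2 + e /\ (v <= e \/ 1 / 2 - e <= v).
  move=> /andP[v1 v2]; have v0 : 0 < v by rewrite -invr_gt0; lra.
  have vv : v * v^-1 = 1 by rewrite mulfV // gt_eqF.
  have h1 : 1 <= v * (2 + d) by rewrite -vv ler_pM2l //; lra.
  have h2 : v * (2 - d) <= 1 by rewrite -vv ler_pM2l //; lra.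
  have lo : 1 / 2 - d <= v by rewrite -(ler_pM2r (_ : 0 < 2 + d)); nra.
  have hi : v <= 1 / 2 + d by rewrite -(ler_pM2r (_ : 0 < 2 - d)); nra.
  by split; [lra | right; lra].
have intA (m : nat) (z : int) : m%:Z <= z -> m%:R <= z%:~R :> R.
  by rewrite -(ler_int R) -pmulrn.
(* The value at index l+6 is governed by b_(l+5), the entry that [shape] classifies at l+3. *)
case: (bK l.+3); first by lia.
- move=> /intA /(cf_val_large Ex (lt_le_trans ltr01 A1)) v.
  by split; [lra | left; lra].
- move=> [/intA h1 h2 h3 /intA h4]; apply: near_half.
  exact: (cf_val_first1 Ex).
- move=> [/intA h1 h2 h3 /intA h4]; apply: near_half.
  exact: (cf_val_second1 Ex).
Qed.

Lemma cf_den_large (N : nat) :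
  exists K : nat, forall k, (K <= k)%N -> N%:Z <= Q k.
Proof.
exists (N + 5)%N => k Nk; have := cf_den_growth (k - 5) b1 b2.
by rewrite (_ : (k - 5).+4.+1 = k); lia.
Qed.

(** Q |D| stays bounded while Q tends to infinity. *)
Lemma cf_err_small (e : R) : 0 < e -> exists K : nat, forall k, (K <= k)%N ->
  `|D k| <= e.
Proof.
move=> e0; have [K1 valK] := cf_val_limits ltr01.
have [N eN] : exists N : nat, 2 / e <= N%:R :> R.
  by exists (Num.truncn (2 / e)).+1; rewrite ltW // truncnS_gt.
have [K2 denK] := cf_den_large N; exists (K1 + K2)%N => k Kk.
have [] := valK k; first by lia.
have := denK k; rewrite -(ler_int R) -pmulrn => /(_ ltac:(lia)) Nk.
move=> + _; rewrite /cf_val => v.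
have D0 := normr_ge0 (D k).
have : 2 / e * `|D k| <= (Q k)%:~R * `|D k|.
  by rewrite ler_wpM2r // (le_trans eN).
move=> /le_trans /(_ v) /(ler_wpM2l (ltW e0)).
by rewrite mulrA mulrCA divff ?gt_eqF //; lra.
Qed.

End Asymptotics.

(** * Pairs in a residue class modulo n *)

Section Congruence.
Variables (R : realType) (theta : R) (b : nat -> int) (x : nat -> R).
Hypothesis Ex : cf_expansion theta b x.
Hypothesis shape : large_or_paired_ones b.
Variables (n : nat) (r s : int).
Hypothesis n0 : (0 < n)%N.
Hypothesis s1 : (`|s| <= 1)%N.
Local Notation P := (cf_seq b 0 1).
Local Notation Q := (cf_seq b 1 0).
Local Notation D := (cf_err theta b).
Local Notation val := (cf_val theta b).

(** (r, s) = (1, 0) gives 1/n and (0, 1) gives -theta/n. As n phi = r - s theta, the form at (q, p)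
    becomes the homogeneous one at (n q + s, n p + r). *)
Let phi : R := (r%:~R - s%:~R * theta) / n%:R.
Let g (q : int) : R := n%:R ^+ 2 * (`|q|%:~R * dist_int (q%:~R * theta - phi)).

Let b1 : 0 <= b 1%N. Proof. by case: Ex. Qed.
Let b2 i : 1 <= b i.+2. Proof. by case: Ex. Qed.

Let scaled (q p : int) :
  n%:R ^+ 2 * (`|q|%:~R * `|q%:~R * theta - phi - p%:~R|)
    = (n%:Z * `|q|)%:~R *
      `|(n%:Z * q + s)%:~R * theta - (n%:Z * p + r)%:~R|.
Proof.
have nR : 0 < n%:R :> R by rewrite ltr0n.
have nN : n%:R = `|n%:R| :> R by rewrite gtr0_norm.
transitivity (n%:R * `|q|%:~R * (`|n%:R| * `|q%:~R * theta - phi - p%:~R|)).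
  by rewrite -nN; ring.
rewrite -normrM intrM -pmulrn; congr (_ * `|_|).
by rewrite /phi !intrD !intrM -!pmulrn; field; rewrite gt_eqF.
Qed.

Let g_le (q p : int) : g q <= (n%:Z * `|q|)%:~R *
      `|(n%:Z * q + s)%:~R * theta - (n%:Z * p + r)%:~R|.
Proof.
rewrite -scaled /g ler_wpM2l ?exprn_ge0 // ler_wpM2l ?ler0z //.
exact: dist_int_le.
Qed.

Let err_mul (l : nat) (m : int) :
  `|(m * Q l)%:~R * theta - (m * P l)%:~R| = `|m%:~R| * `|D l|.
Proof. by rewrite -normrM /cf_err; congr `|_|; rewrite !intrM; ring. Qed.

(** The denominator m Q_l equals n q + s with |s| <= 1, so n |q| exceeds it by at most 1: hence the
    added 1. *)
Lemma scaled_inhom_le (l : nat) (m : int) : 0 < m -> 1 <= Q l ->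
  (n %| m * P l - r)%Z -> (n %| m * Q l - s)%Z ->
  exists q : int, [/\ Q l <= n%:Z * `|q| + 1 &
    g q <= (m * Q l + 1)%:~R * (m%:~R * `|D l|)].
Proof.
move=> m0 Q1 /dvdzP[p pE] /dvdzP[q qE]; exists q.
have pE' : n%:Z * p + r = m * P l by rewrite [_ * p]mulrC -pE subrK.
have qE' : n%:Z * q + s = m * Q l by rewrite [_ * q]mulrC -qE subrK.
have mQ : Q l <= m * Q l by nia.
have nq : n%:Z * `|q| = `|n%:Z * q| by rewrite normrM.
split; first by rewrite nq; lia.
apply: le_trans (g_le q p) _; rewrite pE' qE' err_mul.
have mR : 0 <= m%:~R :> R by rewrite ler0z ltW.
rewrite (ger0_norm mR) ler_wpM2r ?mulr_ge0 //.
by rewrite ler_int nq; lia.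
Qed.

Hypothesis class_return : forall K, exists2 l, (K <= l)%N &
  (n %| P l - r)%Z /\ (n %| Q l - s)%Z.

(** A convergent in the class, with multiplier 1, gives at most (Q + 1) |D| = Q |D| + |D|: one e/2
    is spent on the approach of Q |D| to at most 1/2, the other on |D|. *)
Lemma scaled_inhom_upper (e : R) (N : nat) : 0 < e ->
  exists2 q : int, (N <= `|q|)%N & g q <= 1 / 2 + e.
Proof.
move=> e0; have e20 : 0 < e / 2 by lra.
have [K1 valK] := cf_val_limits Ex shape e20.
have [K2 errK] := cf_err_small Ex shape e20.
have [K3 denK] := cf_den_large Ex (n * N + 1).
have [l Kl [hP hQ]] := class_return (K1 + K2 + K3).
have [v _] := valK l ltac:(lia); have d := errK l ltac:(lia).
have q1 := denK l ltac:(lia).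
have [] := @scaled_inhom_le l 1; rewrite ?mul1r //; first lia.
move=> q [nq gq]; exists q; first nia.
apply: le_trans gq _; rewrite intrD mulrDl !mul1r.
by rewrite /cf_val in v; lra.
Qed.

Lemma scaled_inhom_upper0 :
  (forall (e : R) (K : nat), 0 < e -> exists l (m : int),
     [/\ (K <= l)%N, val l <= e, (n %| m * P l - r)%Z & (n %| m * Q l - s)%Z]) ->
  forall (e : R) (N : nat), 0 < e ->
  exists2 q : int, (N <= `|q|)%N & g q <= e.
Proof.
(* The final bound is 2 m'^2 [val l] with a multiplier m' <= 2n, whence 8 n^2. *)
move=> mult e N e0; pose c : R := 8 * n%:R ^+ 2.
have nR : 1 <= n%:R :> R by rewrite ler1n.
have c0 : 0 < c by rewrite mulr_gt0 // exprn_gt0 //; lra.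
have [K denK] := cf_den_large Ex (n * N + 1).
have [l [m [Kl v hP hQ]]] := mult (e / c) K (divr_gt0 e0 c0).
have q1 := denK l Kl.
have n0' : n%:Z != 0 by lia.
(* Reducing m modulo n keeps the class and bounds the multiplier; adding n makes it positive. *)
pose m' := (m %% n)%Z + n%:Z.
have [m1 m2] : n%:Z <= m' /\ m' <= 2 * n%:Z.
  by have := modz_ge0 m n0'; have := ltz_mod m n0'; rewrite /m'; lia.
have mm (y t : int) : (n %| m * y - t)%Z -> (n %| m' * y - t)%Z.
  rewrite (_ : m' * y - t = (m * y - t) + n%:Z * ((1 - (m %/ n)%Z) * y)).
    by move=> h; rewrite rpredD // dvdz_mulr.
  by rewrite /m' {2}(divz_eq m n); ring.
clearbody m'; have [] := @scaled_inhom_le l m'; [lia|lia|exact: mm|exact: mm|].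
move=> q [nq gq]; exists q; first nia.
apply: le_trans gq _.
have m'0 : 0 <= m'%:~R :> R by rewrite ler0z; lia.
have le1 : (m' * Q l + 1)%:~R <= (2 * m' * Q l)%:~R :> R by rewrite ler_int; nia.
apply: le_trans (ler_wpM2r (mulr_ge0 m'0 (normr_ge0 _)) le1) _.
have -> : (2 * m' * Q l)%:~R * (m'%:~R * `|D l|) = 2 * m'%:~R ^+ 2 * val l.
  by rewrite /cf_val !intrM; ring.
apply: (@le_trans _ _ (c * val l)).
  apply: ler_wpM2r; first by rewrite mulr_ge0 // ler0z; lia.
  have : m'%:~R <= 2 * n%:R :> R.
    by rewrite -(ler_int R) intrM -pmulrn in m2.
  by rewrite /c; nra.
by rewrite -ler_pdivlMl // mulrC.
Qed.

(** A value below 1/2 - e would, by [legendre], come from a multiple of a convergent l. Then [val l]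
    is below 1/2 - e/2, hence at most d by [cf_val_limits], which the hypothesis excludes. *)
Lemma scaled_inhom_lower (d : R) (K : nat) : 0 < d ->
  (forall l (m : int), (K <= l)%N -> val l <= d ->
     (n %| m * P l - r)%Z -> ~~ (n %| m * Q l - s)%Z) ->
  forall e : R, 0 < e ->
  exists N : nat, forall q : int, (N <= `|q|)%N -> 1 / 2 - e <= g q.
Proof.
move=> d0 nomult e e0; pose e' := Num.min (e / 2) d.
have e'0 : 0 < e' by rewrite lt_min; apply/andP; split; lra.
have ee' : e' <= e / 2 by rewrite ge_min lexx.
have de' : e' <= d by rewrite ge_min lexx orbT.
have [K1 valK] := cf_val_limits Ex shape e'0.
pose k := (K + K1)%N.
have [M eM] : exists M : nat, e^-1 <= M%:R :> R.
  by exists (Num.truncn e^-1).+1; rewrite ltW // truncnS_gt.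
(* Q_(k+4) brings |X| into the range of [legendre]; M >= 1/e forces t <= e/2, so replacing n |q| by
   |X| <= n |q| + 1 costs at most e/2. *)
exists (`|Q k.+4| + M + 2)%N => q Nq; rewrite leNgt; apply/negP.
have [p pE] := dist_int_attained (q%:~R * theta - phi).
rewrite /g pE scaled.
pose X : int := n%:Z * q + s; pose Y : int := n%:Z * p + r.
rewrite -/X -/Y.
pose t : R := `|X%:~R * theta - Y%:~R|; rewrite -/t => gq.
have t0 : 0 <= t by exact: normr_ge0.
have nq : n%:Z * `|q| = `|n%:Z * q| by rewrite normrM.
have XQ : Q k.+4 + 1 <= `|X| by rewrite /X; nia.
have Xn : `|X| <= n%:Z * `|q| + 1 by rewrite nq /X; lia.
have nM : M%:Z <= n%:Z * `|q| by nia.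
have tM : M%:R * t <= 1 / 2 - e.
  apply: le_trans (ltW gq); apply: ler_wpM2r => //.
  by rewrite -(ler_int R) -pmulrn in nM.
have te : t <= e / 2.
  have : e^-1 * t <= 1 / 2 by have := ler_wpM2r t0 eM; lra.
  by rewrite -(ler_pM2l e0) mulrA mulfV ?gt_eqF //; lra.
have Xt : `|X|%:~R * t < 1 / 2 - e / 2.
  have : `|X|%:~R * t <= (n%:Z * `|q| + 1)%:~R * t.
    by apply: ler_wpM2r => //; rewrite ler_int.
  by rewrite intrD mulrDl mul1r; lra.
(* [legendre] wants a positive denominator, so both entries of the pair are multiplied by the sign
   of X; the sign returns in the multiplier passed to [nomult]. *)
have [Y' tE YE] : exists2 Y', t = `|(`|X|)%:~R * theta - Y'%:~R| &
    Y = (-1) ^+ (X < 0)%R * Y'.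
  exists ((-1) ^+ (X < 0)%R * Y); last first.
    by rewrite mulrA -expr2 sqrr_sign mul1r.
  rewrite /t; case: (ltrP X 0) => X0; last first.
    by rewrite expr0 mul1r (ger0_norm X0).
  rewrite (ltr0_norm X0) expr1 mulN1r !rmorphN /= -normrN; congr `|_|; ring.
have XE : X = (-1) ^+ (X < 0)%R * `|X| by rewrite {1}(numEsign X).
have kX : Q k.+4 <= `|X| by move: XQ; clear; lia.
have Xsmall : `|X|%:~R * `|(`|X|)%:~R * theta - Y'%:~R| < 1 / 2 :> R.
  by rewrite -tE (lt_trans Xt) // gtrBl; lra.
have [] := legendre Ex kX Xsmall.
move=> l [m [kl Ym Xm]].
have v : val l <= `|X|%:~R * t.
  rewrite tE Ym Xm err_mul.
  have Ql0 := cf_den_ge0 l b1 b2.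
  have mQ : 1 <= m * Q l.
    by have := cf_den_ge0 k.+4 b1 b2; move: XQ; rewrite Xm; clear; lia.
  have m1 : 1 <= m by move: Ql0 mQ; clear; nia.
  have m0 : 0 <= m%:~R :> R by rewrite ler0z (le_trans _ m1).
  rewrite (ger0_norm m0) /cf_val mulrA ler_wpM2r // -!intrM ler_int.
  have : Q l <= m * Q l by rewrite ler_peMl.
  by move: Ql0 m1; clear; nia.
have [Kl Kl1] : (K <= l)%N /\ (K1 <= l)%N by move: kl; rewrite /k; clear; lia.
have [_ [small|big]] := valK l Kl1; last first.
  have := le_lt_trans v (lt_le_trans Xt (lerB (lexx _) ee')).
  by rewrite ltNge big.
have := nomult l ((-1) ^+ (X < 0)%R * m) Kl (le_trans small de').
rewrite -!mulrA -Ym -Xm -YE -XE /X /Y !addrK !dvdz_mulr //.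
by move=> /(_ isT).
Qed.

Lemma scaled_inhom_const :
  [set 0%:E; (1 / 2)%:E] ((n%:R ^+ 2)%:E * inhom_const theta phi)%E.
Proof.
have n2 : 0 < n%:R ^+ 2 :> R by rewrite exprn_gt0 // ltr0n.
have [mult|nomult] := pselect (forall (e : R) (K : nat), 0 < e ->
  exists l (m : int),
  [/\ (K <= l)%N, val l <= e, (n %| m * P l - r)%Z & (n %| m * Q l - s)%Z]).
  left; apply: inhom_const_eq => // e e0.
    by move=> N; rewrite add0r; exact: scaled_inhom_upper0.
  exists 0%N => q _; rewrite sub0r (@le_trans _ _ 0) //; first by lra.
  apply: mulr_ge0; first exact: ltW.
  apply: mulr_ge0; first by rewrite ler0z.
  by have [p ->] := dist_int_attained (q%:~R * theta - phi).
right; apply: inhom_const_eq => // e e0.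
  by move=> N; exact: scaled_inhom_upper.
have /existsNP[d /existsNP[K /not_implyP[d0 none]]] := nomult.
apply: (@scaled_inhom_lower d K) => // l m Kl v hP; apply/negP => hQ.
by apply: none; exists l, m.
Qed.

End Congruence.

Lemma inhom_const_of_expansion (R : realType) (theta : R) (b : nat -> int)
    (x : nat -> R) (n : nat) :
  cf_expansion theta b x -> large_or_paired_ones b -> (2 <= n)%N ->
  completely_periodic_mod n b ->
  forall phi : R, phi = 1 / n%:R \/ phi = - theta / n%:R ->
    [set 0%:E; (1 / 2)%:E] ((n%:R ^+ 2)%:E * inhom_const theta phi)%E.
Proof.
move=> Ex shape n2 per phi [->|->].
  have -> : 1 / n%:R = (1%:~R - 0%:~R * theta) / n%:R by rewrite mul0r subr0.
  apply: (scaled_inhom_const Ex) => //; first exact: ltnW.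
  move=> K; have [k Kk [h1 h2 _ _]] := convergents_return n2 per K.
  by exists k.+1; [exact: leqW | rewrite subr0].
have -> : - theta / n%:R = (0%:~R - 1%:~R * theta) / n%:R by rewrite mul1r sub0r.
apply: (scaled_inhom_const Ex) => //; first exact: ltnW.
move=> K; have [k Kk [_ _ h1 h2]] := convergents_return n2 per K.
by exists k; rewrite ?subr0.
Qed.

(** * Regular continued fractions *)

Lemma irrational_complete_quotient (R : realType) (theta : R) (i : nat) :
  irrational theta -> irrational (complete_quotient theta i).
Proof.
move=> irr; elim: i => //= i IH [q _ qE]; apply: IH.
rewrite -/(complete_quotient theta i) in qE.
exists (q^-1 + (Num.floor (complete_quotient theta i))%:~R) => //.
by rewrite rmorphD /= fmorphV /= qE invrK ratr_int subrK.
Qed.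

Lemma complete_quotient_gt1 (R : realType) (theta : R) (i : nat) :
  irrational theta -> 1 < complete_quotient theta i.+1.
Proof.
move=> irr; have irri := @irrational_complete_quotient _ _ i irr.
rewrite [complete_quotient _ _]/=; rewrite -/(complete_quotient theta i).
move: (complete_quotient theta i) irri => y irry.
have h1 := floor_le y; have h2 := floorD1_gt y; rewrite intrD in h2.
rewrite invf_gt1; first by rewrite ltrBlDl.
rewrite subr_gt0 lt_neqAle h1 andbT; apply/eqP => e; apply: irry.
by exists (Num.floor y)%:~R => //; rewrite ratr_int e.
Qed.

Lemma partial_quotient_ge1 (R : realType) (theta : R) : irrational theta ->
  forall i, 1 <= partial_quotient theta i.+1.
Proof.
by move=> irr i; rewrite /partial_quotient floor_ge_int ltW ?complete_quotient_gt1.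
Qed.

Lemma regular_cf_expansion (R : realType) (theta : R) : irrational theta ->
  cf_expansion theta (partial_quotient theta) (complete_quotient theta).
Proof.
move=> irr; have bS := partial_quotient_ge1 irr.
split=> // [i|i|]; last exact: le_trans (bS 0%N).
  by rewrite [complete_quotient theta i.+1]/= invrK addrC subrK.
exact: lt_trans (complete_quotient_gt1 i irr).
Qed.

Lemma limn_esup_lt (R : realType) (u : nat -> \bar R) (l : \bar R) :
  (limn_esup u < l)%E -> exists N, forall i, (N <= i)%N -> (u i < l)%E.
Proof.
rewrite /limn_esup limf_esupE => /ereal_inf_lt [_ [V [N _ NV] <-] ul].
exists N => i Ni; apply: le_lt_trans ul; apply: ereal_sup_ubound.
by exists i => //; exact: NV.
Qed.

Lemma cum_lenS (len : nat -> nat) (i : nat) :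
  cum_len len i.+1 = (cum_len len i + len i.+1)%N.
Proof. by rewrite /cum_len big_nat_recr. Qed.

Lemma cum_len_le (len : nat -> nat) (i j : nat) :
  (i <= j)%N -> (cum_len len i <= cum_len len j)%N.
Proof.
move=> /subnK <-; elim: (j - i)%N => // k IH.
by rewrite addSn cum_lenS (leq_trans IH) // leq_addr.
Qed.

(** The bounded nondecreasing sequence [cum_len] attains its maximum at some I and is constant from
    there on. *)
Lemma finitely_many_terms_len0 (len : nat -> nat) : finitely_many_terms len ->
  exists I : nat, forall i, (I <= i)%N -> len i.+1 = 0%N.
Proof.
move=> [M leM].
have ex : exists m, `[< exists i, cum_len len i = m >].
  by exists (cum_len len 0); apply/asboolP; exists 0%N.
have ub m : `[< exists i, cum_len len i = m >] -> (m <= M)%N.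
  by move=> /asboolP[i <-].
case: (ex_maxnP ex ub) => m /asboolP[I Im] mmax; exists I => i Ii.
have := mmax (cum_len len i.+1); rewrite cum_lenS.
have := cum_len_le len Ii; rewrite Im => h1 h2.
have : (cum_len len i + len i.+1 <= m)%N.
  by apply: h2; apply/asboolP; exists i.+1; rewrite cum_lenS.
lia.
Qed.

Lemma interleaves_position (len : nat -> nat) (I k : nat) :
  (I + cum_len len I <= k)%N ->
  exists i m, [/\ (I <= i)%N, (m <= len i.+1)%N & k = (i + cum_len len i + m)%N].
Proof.
move=> /subnK <-; elim: (_ - _)%N => [|j [i [m [Ii ml kE]]]].
  by exists I, 0%N; rewrite addn0 add0n.
rewrite addSn kE; move: ml; rewrite leq_eqVlt => /orP[/eqP ->|ml].
  by exists i.+1, 0%N; split => //; [lia | rewrite cum_lenS; lia].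
by exists i, m.+1; split => //; lia.
Qed.

Lemma interleaves_large_or_paired_ones (R : realType) (b a c : nat -> int)
    (len : nat -> nat) :
  interleaves b a c len -> (forall i, 1 <= b i.+1) ->
  ((a i)%:~R : R) @[i --> \oo] --> +oo ->
  finitely_many_terms len \/
    limn_esup (fun i : nat => ((c i)%:~R : R)%:E) = 1%:E ->
  (forall i : nat, (1 <= i)%N -> len i = 0%N \/ len i = 2%N) ->
  large_or_paired_ones b.
Proof.
move=> ilv b1 alarge fin len02 A.
have [I1 aA] : exists I, forall i, (I <= i)%N -> A%:Z <= a i.
  have [I _ IA] := (cvgryPge _).1 alarge A%:R.
  by exists I => i /IA /=; rewrite -(ler_int R) -pmulrn.
have [I2 len2] : exists I, forall i, (I <= i)%N -> len i.+1 = 0%N \/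
    [/\ len i.+1 = 2%N, b (i + cum_len len i).+1 = 1 &
        b (i + cum_len len i).+2 = 1].
  (* The split is on finiteness itself, not on the disjunction [fin]: the limsup controls the terms
     that occur only if their indices grow past N. *)
  have [/finitely_many_terms_len0[I h]|infin] := pselect (finitely_many_terms len).
    by exists I => i /h; left.
  case: fin => // sup1.
  have [N cN] : exists N, forall i, (N <= i)%N -> c i <= 1.
    (* A limsup of 1 is below 2, and integers below 2 are at most 1; partial quotients being at
       least 1, these terms equal 1. *)
    have [|N cN] := @limn_esup_lt _ (fun i => ((c i)%:~R : R)%:E) 2%:E.
      by rewrite sup1 lte_fin ltr1n.
    by exists N => i /cN; rewrite lte_fin -[2]/(2%:~R) ltr_int; lia.
  have [I NI] : exists I, (N <= cum_len len I)%N.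
    apply: contrapT => h; apply: infin; exists N => i.
    by rewrite leqNgt; apply/negP => Ni; apply: h; exists i; exact: ltnW.
  exists I => i Ii; have [|h] := len02 i.+1 isT; [by left|right].
  have NIi := cum_len_le len Ii; have [_ bc] := ilv i.
  have one m : (1 <= m <= 2)%N -> b (i + cum_len len i + m)%N = 1.
    move=> m12; apply/le_anti/andP; split.
      by rewrite bc ?h // cN //; lia.
    by have := b1 (i + cum_len len i + m.-1)%N; rewrite -addnS prednK //; lia.
  by split=> //; [rewrite -addn1 one | rewrite -addn2 one].
pose I := (I1 + I2)%N; exists (I + cum_len len I)%N => k Ik.
have Ik2 : (I + cum_len len I <= k.+2)%N by lia.
have [i [m [Ii ml kE]]] := interleaves_position Ik2.
have [ai _] := ilv i; have [aiS _] := ilv i.+1.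
have Aa : A%:Z <= a i by apply: aA; lia.
have AaS : A%:Z <= a i.+1 by apply: aA; lia.
rewrite cum_lenS in aiS.
(* Offset 0 in the block is the large a_i; offsets 1 and 2 are the two 1's between a_i and
   a_(i+1). *)
move: ml; have [->|[l2 h1 h2]] := len2 i ltac:(lia).
  by case: m kE => // kE _; constructor 1; rewrite kE addn0 ai.
rewrite l2 in aiS *; case: m kE => [|[|[|]]] // kE _.
- by constructor 1; rewrite kE addn0 ai.
- constructor 2; move: kE; rewrite addn1 => -[kE].
  rewrite kE ai h1 h2; split=> //.
  rewrite -aiS in AaS.
  by rewrite (_ : _.+3 = i.+1 + (cum_len len i + 2))%N //; lia.
- constructor 3; move: kE; rewrite addn2 => -[kE].
  rewrite kE ai h1 h2; split=> //.
  rewrite -aiS in AaS.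
  by rewrite (_ : _.+3 = i.+1 + (cum_len len i + 2))%N //; lia.
Qed.

(** * The expansion of e^(2/k) *)

(* bessel j z = sum_m z^(2m+2j+1) / ((2m)!! (2m+2j+1)!!): these are, up to
   powers of z, the modified spherical Bessel functions, whose ratios are
   the complete quotients of coth (1/k) = [k; 3k, 5k, ...]. *)
Fixpoint bessel_pair (R : realType) (j : nat) : (R -> R) * (R -> R) :=
  if j is j'.+1 then
    let u := bessel_pair R j' in
    (u.2, fun z => z ^+ 2 * u.1 z - (2 * j'%:R + 3) * u.2 z)
  else (fun z => 2^-1 * (expR z - expR (- z)),
        fun z => z * (2^-1 * (expR z + expR (- z)))
                 - 2^-1 * (expR z - expR (- z))).

Definition bessel (R : realType) (j : nat) : R -> R := (bessel_pair R j).1.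

Lemma besselS (R : realType) (j : nat) (z : R) :
  bessel j.+2 z = z ^+ 2 * bessel j z - (2 * j%:R + 3) * bessel j.+1 z.
Proof. by []. Qed.

Lemma bessel_at0 (R : realType) (j : nat) : bessel j 0 = 0 :> R.
Proof.
suff [] : bessel j 0 = 0 :> R /\ bessel j.+1 0 = 0 :> R by [].
elim: j => [|j [h0 h1]].
  by rewrite /bessel /= oppr0 subrr mul0r mulr0 subrr.
by rewrite besselS h0 h1 !mulr0 subrr.
Qed.

Lemma is_derive_expRN (R : realType) (z : R) :
  is_derive z 1 (fun y => expR (- y)) (- expR (- z)).
Proof.
have h : is_derive z 1 (expR \o -%R) (expR (- z) *: - 1).
  exact: is_derive1_comp.
by apply: is_derive_eq; rewrite /GRing.scale /= mulrN1.
Qed.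

(** Differentiating the recurrence gives 2 z B_(j+1) + z^3 B_j - (2j+5) z B_(j+1), which is z
    B_(j+2) by the recurrence again. The induction carries two consecutive indices. *)
Lemma is_derive_bessel (R : realType) (j : nat) (z : R) :
  is_derive z 1 (bessel j.+1 : R -> R) (z * bessel j z).
Proof.
have zz : ((id : R -> R) * id) z = z * z by [].
have bessel1 :
  bessel 1 z = z * (2^-1 * (expR z + expR (- z))) - bessel 0 z by [].
have sc (u v : R) : u *: v = u * v by [].
pose f' (f : R -> R) (d : R) := is_derive z 1 f d.
have dE : f' expR (expR z) := is_derive_expR z.
have dN : f' (fun y => expR (- y)) (- expR (- z)) := is_derive_expRN z.
have dI : f' id 1 := is_derive_id z 1.
suff [] : is_derive z 1 (bessel j.+1 : R -> R) (z * bessel j z) /\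
          is_derive z 1 (bessel j.+2 : R -> R) (z * bessel j.+1 z) by [].
have cosh' : f' (fun y => 2^-1 * (expR y + expR (- y))) (bessel 0 z).
  exact: is_derive_eq (is_deriveZ 2^-1 (is_deriveD dE dN)) _.
have sinh' : f' (bessel 0) (2^-1 * (expR z + expR (- z))).
  apply: is_derive_eq (is_deriveZ 2^-1 (is_deriveB dE dN)) _.
  by rewrite opprK.
have h1 : is_derive z 1 (bessel 1 : R -> R) (z * bessel 0 z).
  apply: is_derive_eq (is_deriveB (is_deriveM dI cosh') sinh') _.
  by rewrite !sc; ring.
elim: j => [|j [h2 h3]]; split; [exact: h1 | | exact: h3 |].
- apply: is_derive_eq (is_deriveB (is_deriveM (is_deriveM dI dI) sinh')
    (is_deriveZ (2 * 0%:R + 3) h1)) _.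
  by rewrite !sc zz bessel1 mulr0; ring.
- apply: is_derive_eq (is_deriveB (is_deriveM (is_deriveM dI dI) h2)
    (is_deriveZ (2 * j.+1%:R + 3) h3)) _.
  by rewrite !sc zz besselS -natr1; ring.
Qed.

(** All these functions vanish at 0, and the derivative of each is z times the previous one: the
    mean value theorem passes positivity up from sinh. *)
Lemma bessel_gt0 (R : realType) (j : nat) (z : R) : 0 < z -> 0 < bessel j z.
Proof.
elim: j z => [|j IH] z z0.
  by rewrite mulr_gt0 // subr_gt0 ltr_expR; lra.
have d (y : R) : is_derive y 1 (bessel j.+1 : R -> R) (y * bessel j y).
  exact: is_derive_bessel.
have [|y] := MVT z0 (fun y _ => d y).
  by apply: derivable_within_continuous => y _; case: (d y).
rewrite in_itv /= => /andP[y0 _]; rewrite bessel_at0 !subr0 => ->.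
by rewrite mulr_gt0 // mulr_gt0 // IH.
Qed.

(** The complete quotients of coth (1/k). Case 0 follows the same pattern with cosh z / z in the
    role of the function of index -1. *)
Definition coth_quotient (R : realType) (k j : nat) : R :=
  let z : R := k%:R^-1 in
  if j is j'.+1 then z * bessel j' z / bessel j'.+1 z
  else (expR z + expR (- z)) / (expR z - expR (- z)).

Lemma coth_quotient_gt0 (R : realType) (k j : nat) :
  (0 < k)%N -> 0 < coth_quotient R k j.
Proof.
move=> k0; have z0 : 0 < k%:R^-1 :> R by rewrite invr_gt0 ltr0n.
case: j => [|j] /=; last by rewrite divr_gt0 ?mulr_gt0 ?bessel_gt0.
rewrite divr_gt0 ?(addr_gt0 (expR_gt0 _) (expR_gt0 _)) // subr_gt0 ltr_expR.
by apply: (lt_trans _ z0); rewrite oppr_lt0.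
Qed.

(** This is the recurrence [besselS] divided by z B_(j+1), with 1/z = k. *)
Lemma coth_quotientS (R : realType) (k j : nat) : (0 < k)%N ->
  coth_quotient R k j = ((2 * j + 1) * k)%:R + (coth_quotient R k j.+1)^-1.
Proof.
move=> k0; rewrite natrM natrD natrM.
have : (k%:R : R) = (k%:R^-1)^-1 by rewrite invrK.
have : 0 < k%:R^-1 :> R by rewrite invr_gt0 ltr0n.
rewrite /coth_quotient; move: (k%:R^-1) => z z0 ->.
have zn : z != 0 by rewrite gt_eqF.
case: j => [|j]; last first.
  have h1 := bessel_gt0 j z0; have h2 := bessel_gt0 j.+1 z0.
  have := bessel_gt0 j.+2 z0; rewrite besselS -natr1 => h3.
  by field; rewrite !gt_eqF.
have h1 := bessel_gt0 1 z0.
have sz : expR z - expR (- z) != 0.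
  by have := bessel_gt0 0 z0; rewrite /bessel /= pmulr_rgt0 // => /gt_eqF ->.
have -> : bessel 0 z = 2^-1 * (expR z - expR (- z)) by [].
have b1 : bessel 1 z =
  z * (2^-1 * (expR z + expR (- z))) - 2^-1 * (expR z - expR (- z)) by [].
rewrite b1; rewrite b1 in h1.
by field; rewrite sz zn /= andbT; apply/eqP => e; move: h1; lra.
Qed.

Lemma expR_coth_quotient (R : realType) (k : nat) : (0 < k)%N ->
  expR (2 / k%:R) = (coth_quotient R k 0 + 1) / (coth_quotient R k 0 - 1) :> R.
Proof.
move=> k0; have z0 : 0 < k%:R^-1 :> R by rewrite invr_gt0 ltr0n.
rewrite /coth_quotient mulr_natl mulr2n expRD; move: (k%:R^-1) z0 => z z0.
have e0 := expR_gt0 z; have e1 := expR_gt0 (- z).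
have ee : expR z * expR (- z) = 1 by rewrite expRxMexpNx_1.
have s0 : expR z - expR (- z) != 0.
  by rewrite subr_eq0 gt_eqF // ltr_expR; lra.
transitivity (expR z / expR (- z)); last first.
  by field; rewrite s0 !gt_eqF //=; lra.
apply: (canRL (mulfK (lt0r_neq0 e1))).
by rewrite -mulrA ee mulr1.
Qed.

(** * Expansions made of blocks of fixed length *)

Definition interlace (T : Type) (m : nat) (f : nat -> nat -> T) (i : nat) : T :=
  f (i %% m)%N (i %/ m)%N.

Lemma interlaceE (T : Type) (m : nat) (f : nat -> nat -> T) (j r : nat) :
  (r < m)%N -> interlace m f (j * m + r) = f r j.
Proof.
move=> rm; have m0 : (0 < m)%N by exact: leq_ltn_trans rm.
by rewrite /interlace modnMDl modn_small // divnMDl // divn_small // addn0.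
Qed.

Lemma interlaceP (m i : nat) : (0 < m)%N ->
  exists j r, (r < m)%N /\ i = (j * m + r)%N.
Proof.
by move=> m0; exists (i %/ m)%N, (i %% m)%N; rewrite ltn_mod -divn_eq.
Qed.

Lemma interlace_periodic (m n : nat) (f : nat -> nat -> int) :
  (0 < m)%N -> (0 < n)%N ->
  (forall r j, (f r (j + n)%N = f r j %[mod n%:Z])%Z) ->
  completely_periodic_mod n (interlace m f).
Proof.
move=> m0 n0 fn; exists (n * m)%N; split; first by rewrite muln_gt0 m0 n0.
move=> i; have [j [r [rm ->]]] := interlaceP i m0.
by rewrite addnAC -mulnDl !interlaceE.
Qed.

(* e^(2/k) = [1; m-1, 1, 1, 3m-1, 1, 1, 5m-1, 1, ...], k = 2m *)
Definition even_terms (m r j : nat) : int :=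
  if r is 1%N then ((2 * j + 1) * m)%N%:Z - 1 else 1.

(** Complete quotients of (T_0 + 1) / (T_0 - 1), where T_j = (2j+1) 2m + 1/T_(j+1): three steps lead
    from (T_j + 1) / (T_j - 1) to the same expression in T_(j+1). *)
Definition even_quotients (R : realType) (T : nat -> R) (r j : nat) : R :=
  match r with
  | 0%N => (T j + 1) / (T j - 1)
  | 1%N => (T j - 1) / 2
  | _ => 2 * T j.+1 / (T j.+1 + 1)
  end.

(* e^(2/k) = [1; (k-1)/2, 6k, (5k-1)/2, 1, 1, (7k-1)/2, 18k, ...], k = 2h+1 *)
Definition odd_terms (h r j : nat) : int :=
  match r with
  | 1%N => ((6 * j + 1) * h + 3 * j)%N
  | 2%N => (2 * ((6 * j + 3) * (2 * h + 1)))%N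
  | 3%N => ((6 * j + 5) * h + 3 * j + 2)%N
  | _ => 1
  end.

(** For odd k, halving T_j - 1 leaves an integer plus 1 / (2 T_(j+1)), and the factor 2 is
    compensated only two terms later, so a block consumes three terms of T. *)
Definition odd_quotients (R : realType) (T : nat -> R) (r j : nat) : R :=
  match r with
  | 0%N => (T (3 * j)%N + 1) / (T (3 * j)%N - 1)
  | 1%N => (T (3 * j)%N - 1) / 2
  | 2%N => 2 * T (3 * j).+1
  | 3%N => T (3 * j).+2 / 2
  | _ => 2 * T (3 * j).+3 / (T (3 * j).+3 + 1)
  end.

Lemma even_terms_large m : (0 < m)%N ->
  large_or_paired_ones (interlace 3 (even_terms m)).
Proof.
move=> m0 A; exists (A * 3 + 3)%N => k Ak.
have [j [r [rm kE]]] := @interlaceP 3 k isT.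
have at_ i j' r' : i = (j' * 3 + r')%N -> (r' < 3)%N ->
    interlace 3 (even_terms m) i = even_terms m r' j'.
  by move=> -> ?; exact: interlaceE.
have jA : (A <= j)%N by lia.
have large i : (A <= i)%N -> A%:Z <= even_terms m 1 i by rewrite /even_terms; nia.
case: r rm kE => [|[|[|]]] // _ kE.
- constructor 2.
  rewrite (at_ k.+1 j 1) ?(at_ k.+2 j 2)
    ?(at_ k.+3 j.+1 0) ?(at_ k.+4 j.+1 1); [|lia..].
  by split=> //; apply: large; lia.
- constructor 3.
  rewrite (at_ k.+1 j 2) ?(at_ k.+2 j.+1 0)
    ?(at_ k.+3 j.+1 1) ?(at_ k j 1); [|lia..].
  by split=> //; apply: large; lia.
- constructor 1; rewrite (at_ k.+2 j.+1 1); [|lia..].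
  apply: large; lia.
Qed.

Lemma odd_terms_large h : (0 < h)%N ->
  large_or_paired_ones (interlace 5 (odd_terms h)).
Proof.
move=> h0 A; exists (A * 5 + 5)%N => k Ak.
have [j [r [rm kE]]] := @interlaceP 5 k isT.
have at_ i j' r' : i = (j' * 5 + r')%N -> (r' < 5)%N ->
    interlace 5 (odd_terms h) i = odd_terms h r' j'.
  by move=> -> ?; exact: interlaceE.
have jA : (A <= j)%N by lia.
have large i s : (A <= i)%N -> (0 < s < 4)%N -> A%:Z <= odd_terms h s i.
  by case: s => [|[|[|[|]]]] // Ai _; rewrite /odd_terms; nia.
case: r rm kE => [|[|[|[|[|]]]]] // _ kE.
- constructor 1; rewrite (at_ k.+2 j 2); [|lia..].
  by apply: large.
- constructor 1; rewrite (at_ k.+2 j 3); [|lia..].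
  by apply: large.
- constructor 2.
  rewrite (at_ k.+1 j 3) ?(at_ k.+2 j 4)
    ?(at_ k.+3 j.+1 0) ?(at_ k.+4 j.+1 1); [|lia..].
  by split=> //; apply: large => //; lia.
- constructor 3.
  rewrite (at_ k.+1 j 4) ?(at_ k.+2 j.+1 0)
    ?(at_ k.+3 j.+1 1) ?(at_ k j 3); [|lia..].
  by split=> //; apply: large => //; lia.
- constructor 1; rewrite (at_ k.+2 j.+1 1); [|lia..].
  by apply: large => //; lia.
Qed.

Lemma interlace_cf_expansion (R : realType) (theta : R) (m : nat)
    (b : nat -> nat -> int) (x : nat -> nat -> R) : (1 < m)%N ->
  x 0%N 0%N = theta ->
  (forall j r, (r.+1 < m)%N -> x r j = (b r j)%:~R + (x r.+1 j)^-1) ->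
  (forall j, x m.-1 j = (b m.-1 j)%:~R + (x 0%N j.+1)^-1) ->
  (forall j r, (r < m)%N -> 0 < x r j) ->
  0 <= b 1%N 0%N ->
  (forall j r, (r < m)%N -> (1 < j * m + r)%N -> 1 <= b r j) ->
  cf_expansion theta (interlace m b) (interlace m x).
Proof.
move=> m1 x0 xS xm xp b1 b2; have m0 := ltnW m1; split.
- by rewrite -x0 -(interlaceE x 0 m0).
- move=> i; have [j [r [rm ->]]] := interlaceP i m0.
  have [rm1|rm1] := ltnP r.+1 m.
    by rewrite -addnS !interlaceE // xS.
  have {rm1 rm} -> : r = m.-1 by lia.
  rewrite (_ : (j * m + m.-1).+1 = j.+1 * m + 0)%N; last lia.
  by rewrite !interlaceE ?xm //; lia.
- move=> i; have [j [r [rm ->]]] := interlaceP i.+1 m0.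
  by rewrite interlaceE // xp.
- by rewrite -[1%N]/(0 * m + 1)%N interlaceE.
- move=> i; have [j [r [rm iE]]] := interlaceP i.+2 m0.
  by rewrite iE interlaceE // b2 // -iE.
Qed.

Section CothExpansion.
Variables (R : realType) (k : nat) (T : nat -> R).
Hypothesis k0 : (0 < k)%N.
Hypothesis T0 : forall j, 0 < T j.
Hypothesis TS : forall j, T j = ((2 * j + 1) * k)%:R + (T j.+1)^-1.

Let T_gt (j : nat) : ((2 * j + 1) * k)%:R < T j.
Proof. by rewrite TS ltrDl invr_gt0. Qed.

Lemma even_cf_expansion (m : nat) : (0 < m)%N -> k = (2 * m)%N ->
  cf_expansion ((T 0%N + 1) / (T 0%N - 1)) (interlace 3 (even_terms m))
    (interlace 3 (even_quotients T)).
Proof.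
move=> m0 kE.
have T1 j : 1 < T j.
  by apply: le_lt_trans (T_gt j); rewrite ler1n; nia.
have mE : k%:R = 2 * m%:R :> R by rewrite kE natrM.
apply: interlace_cf_expansion => //=.
- move=> j [|[|[|]]] //= _; rewrite /even_terms.
    have Tj := T1 j; by field; rewrite !gt_eqF //; lra.
  have Tj := T1 j.+1.
  rewrite (TS j) natrM mE intrD -pmulrn natrM natrD natrM rmorphN /=.
  by field; rewrite !gt_eqF //; lra.
- move=> j; have Tj := T1 j.+1; rewrite /even_terms.
  by field; rewrite !gt_eqF //; lra.
- move=> j [|[|[|]]] //= _; have h1 := T1 j; have h2 := T1 j.+1;
    by rewrite divr_gt0 //; lra.
- rewrite /even_terms; lia.
- by move=> j [|[|[|]]] //= _; rewrite /even_terms; nia.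
Qed.

Lemma odd_cf_expansion (h : nat) : (0 < h)%N -> k = (2 * h + 1)%N ->
  cf_expansion ((T 0%N + 1) / (T 0%N - 1)) (interlace 5 (odd_terms h))
    (interlace 5 (odd_quotients T)).
Proof.
move=> h0 kE.
have T1 j : 1 < T j.
  by apply: le_lt_trans (T_gt j); rewrite ler1n; nia.
have hE : k%:R = 2 * h%:R + 1 :> R by rewrite kE natrD natrM.
apply: interlace_cf_expansion => //=.
- move=> j [|[|[|[|[|]]]]] //= _; rewrite /odd_terms.
  + have Tj := T1 (3 * j)%N; by field; rewrite !gt_eqF //; lra.
  + have Tj := T1 (3 * j).+1.
    rewrite (TS (3 * j)) -pmulrn !(natrM, natrD) hE.
    by field; rewrite !gt_eqF //; lra.
  + have Tj := T1 (3 * j).+2.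
    rewrite (TS (3 * j).+1) -pmulrn -addn1 !(natrM, natrD) hE.
    by field; rewrite !gt_eqF //; lra.
  + have Tj := T1 (3 * j).+3.
    rewrite (TS (3 * j).+2) -pmulrn -addn2 !(natrM, natrD) hE.
    by field; rewrite !gt_eqF //; lra.
- move=> j; rewrite mulnSr addn3; have Tj := T1 (3 * j).+3; rewrite /odd_terms.
  by field; rewrite !gt_eqF //; lra.
- move=> j [|[|[|[|[|]]]]] //= _; have h1 := T1 (3 * j)%N;
    have h2 := T1 (3 * j).+1; have h3 := T1 (3 * j).+2;
    have h4 := T1 (3 * j).+3; by [rewrite divr_gt0 //; lra | lra].
- by move=> j [|[|[|[|[|]]]]] //= _; rewrite /odd_terms; nia.
Qed.

End CothExpansion.

Lemma expR_expansion (R : realType) (k n : nat) : (1 < k)%N -> (0 < n)%N ->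
  exists b x, [/\ cf_expansion (expR (2 / k%:R) : R) b x,
    large_or_paired_ones b & completely_periodic_mod n b].
Proof.
move=> k1 n0; have k0 : (0 < k)%N by exact: ltnW.
have Tp j := coth_quotient_gt0 R j k0; have TS j := coth_quotientS R j k0.
rewrite expR_coth_quotient //.
have kE := odd_double_half k; case: (odd k) kE => kE.
  have h0 : (0 < k./2)%N by lia.
  exists (interlace 5 (odd_terms k./2)),
    (interlace 5 (odd_quotients (coth_quotient R k))).
  split; [apply: (odd_cf_expansion k0 Tp TS h0); lia | exact: odd_terms_large |].
  apply: interlace_periodic => // r j; apply/eqP; rewrite eqz_mod_dvd.
  (* Every entry is affine in the block number j; the witnesses are the slopes. *)
  apply/dvdzP; case: r => [|[|[|[|r]]]] /=; rewrite /odd_terms.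
  - by exists 0; rewrite subrr mul0r.
  - by exists (6 * k./2 + 3)%N%:Z; lia.
  - by exists (12 * (2 * k./2 + 1))%N%:Z; lia.
  - by exists (6 * k./2 + 3)%N%:Z; lia.
  - by exists 0; rewrite subrr mul0r.
have h0 : (0 < k./2)%N by lia.
exists (interlace 3 (even_terms k./2)),
  (interlace 3 (even_quotients (coth_quotient R k))).
split; [apply: (even_cf_expansion k0 Tp TS h0); lia | exact: even_terms_large |].
apply: interlace_periodic => // r j; apply/eqP; rewrite eqz_mod_dvd.
apply/dvdzP; case: r => [|[|r]] /=; rewrite /even_terms.
- by exists 0; rewrite subrr mul0r.
- by exists (2 * k./2)%N%:Z; lia.
- by exists 0; rewrite subrr mul0r.
Qed.

Theorem theorem3p3 (R : realType) :
  (forall (theta : R) (a c : nat -> int) (len : nat -> nat) (n : nat),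
     irrational theta ->
     interleaves (partial_quotient theta) a c len ->
     ((a i)%:~R : R) @[i --> \oo] --> +oo ->
     finitely_many_terms len \/
       limn_esup (fun i : nat => ((c i)%:~R : R)%:E) = 1%:E ->
     (2 <= n)%N ->
     completely_periodic_mod n (partial_quotient theta) ->
     (forall i : nat, (1 <= i)%N -> len i = 0%N \/ len i = 2%N) ->
     forall phi : R, phi = 1 / n%:R \/ phi = - theta / n%:R ->
       [set 0%:E; (1 / 2)%:E] ((n%:R ^+ 2)%:E * inhom_const theta phi)%E) /\
  (forall k n : nat, (2 <= k)%N -> (2 <= n)%N ->
     forall phi : R,
       phi = 1 / n%:R \/ phi = - expR (2 / k%:R) / n%:R ->
       [set 0%:E; (1 / 2)%:E]
         ((n%:R ^+ 2)%:E * inhom_const (expR (2 / k%:R)) phi)%E).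
Proof.
split=> [theta a c len n irr ilv alarge fin n2 per len02|k n k2 n2].
  apply: inhom_const_of_expansion (regular_cf_expansion irr) _ n2 per.
  apply: interleaves_large_or_paired_ones ilv _ alarge fin len02.
  exact: partial_quotient_ge1.
(* For k = 2 this expansion contains a 0 and is not the regular one, so the conclusion is drawn from
   it directly rather than from the first part. *)
have [b [x [Ex shape per]]] := expR_expansion R k2 (ltnW n2).
exact: inhom_const_of_expansion Ex shape n2 per.
Qed.
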